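(* If $M\in\{2,4\}$, then $\mathfrak{S}_M^{1/2}=\varnothing$. If $M\in\mathbb{N}\setminus\{2,4\}$, then the set $A_M:=\{N\in\mathbb{N}\colon \mathfrak{n}_{-}(M)\leq N\leq\mathfrak{n}_{+}(M)\}$ is nonempty, $\mathfrak{S}_{M,N}^{1/2}\neq\varnothing$ for every $N\in A_M$, and $\mathfrak{S}_{M,N}^{1/2}=\varnothing$ for every $N\in\mathbb{N}\setminus A_M$.
   Context: $\mathbb{N}=\{1,2,3,\ldots\}$ and $\mathbb{R}_+=[0,\infty)$. A sequence $\{a_n\}_{n=0}^\infty\subseteq\mathbb{R}_+$ is a Stieltjes moment sequence if there is a positive Borel measure $\mu$ on $\mathbb{R}_+$ with $a_n=\int_{\mathbb{R}_+}x^n\,d\mu(x)$ for all integers $n\geq 0$ (with $x^0=1$); such $\mu$ is called a representing measure. $\operatorname{supp}$ denotes the closed support. For $M\in\mathbb{N}$, $\mathfrak{S}_M$ is the set of all Stieltjes moment sequences having a representing measure $\mu$ such that $\operatorname{supp}\mu\subseteq(0,\infty)$ and $\operatorname{supp}\mu$ has exactly $M$ elements; $\mathfrak{S}_M^{1/2}$ is the set of all $\{a_n\}_{n=0}^\infty\in\mathfrak{S}_M$ such that $\{\sqrt{a_n}\}_{n=0}^\infty$ is a Stieltjes moment sequence; for $N\in\mathbb{N}$, $\mathfrak{S}_{M,N}^{1/2}$ is the set of all $\{a_n\}_{n=0}^\infty\in\mathfrak{S}_M$ such that $\{\sqrt{a_n}\}_{n=0}^\infty\in\mathfrak{S}_N$.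 Further, $\mathfrak{n}_{-}(M)=\left\lceil\frac{\sqrt{8M+1}-1}{2}\right\rceil$ and $\mathfrak{n}_{+}(M)=\left\lfloor\frac{M+1}{2}\right\rfloor$. *)

(* Defs.v *)
From HB Require Import structures.
From mathcomp Require Import all_boot all_order all_algebra.
From mathcomp Require Import all_classical all_reals all_analysis.

Set Implicit Arguments.
Unset Strict Implicit.
Unset Printing Implicit Defensive.

Import Order.TTheory GRing.Theory Num.Theory.
Import numFieldNormedType.Exports.

Local Open Scope classical_set_scope.
Local Open Scope ring_scope.

(* A positive Borel measure on [0, +oo[ is encoded as a Borel measure on R that
   vanishes on ]-oo, 0[; the closed support is the same in R and in [0, +oo[. *)
Definition on_nonneg (R : realType)
    (mu : {measure set (measurableTypeR R) -> \bar R}) : Prop :=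
  mu [set` `]-oo, 0[] = 0%E.

(* As a_ n is a real number, all moments are required to be finite. *)
Definition represents (R : realType)
    (mu : {measure set (measurableTypeR R) -> \bar R}) (a_ : R^nat) : Prop :=
  on_nonneg mu /\
  forall n : nat, (a_ n)%:E = (\int[mu]_(x in `[0%R, +oo[) (x ^+ n)%:E)%E.

Definition stieltjes (R : realType) : set (R^nat) :=
  [set a_ | (forall n, 0 <= a_ n) /\
    exists mu : {measure set (measurableTypeR R) -> \bar R}, represents mu a_].

Definition msupport (R : realType)
    (mu : {measure set (measurableTypeR R) -> \bar R}) : set R :=
  [set x : R | forall U : set R, open U -> U x -> (0 < mu U)%E].

Definition frakS (R : realType) (M : nat) : set (R^nat) :=
  [set a_ | stieltjes a_ /\
    exists mu : {measure set (measurableTypeR R) -> \bar R},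
      [/\ represents mu a_,
          msupport mu `<=` [set` `]0, +oo[] &
          (msupport mu #= `I_M)%card]].

Definition sqrt_seq (R : realType) (a_ : R^nat) : R^nat :=
  fun n => Num.sqrt (a_ n).

Definition frakS_half (R : realType) (M : nat) : set (R^nat) :=
  [set a_ | frakS M a_ /\ stieltjes (sqrt_seq a_)].

Definition frakS_half2 (R : realType) (M N : nat) : set (R^nat) :=
  [set a_ | frakS M a_ /\ frakS N (sqrt_seq a_)].

Definition n_minus (R : realType) (M : nat) : int :=
  Num.ceil ((Num.sqrt ((8 * M + 1)%:R : R) - 1) / 2).

Definition n_plus (R : realType) (M : nat) : int :=
  Num.floor ((M + 1)%:R / 2 : R).

Definition A_set (R : realType) (M : nat) : set nat :=
  [set N | (1 <= N)%N /\ n_minus R M <= N%:Z <= n_plus R M].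

(* Main.v *)
Require Import Defs.
From HB Require Import structures.
From mathcomp Require Import finmap.
From mathcomp Require Import all_boot all_order all_algebra.
From mathcomp Require Import all_classical all_reals all_analysis.
From mathcomp Require Import measurable_realfun pi_irrational.
From mathcomp Require Import zify lra.

Local Open Scope classical_set_scope.

Import Order.TTheory GRing.Theory Num.Theory.
Import numFieldNormedType.Exports.

(** Let [a] be represented by [mu], let [sqrt a] be represented by [nu], and put
    [X = supp mu], [S = supp nu].  The identity [a n = (sqrt (a n)) ^ 2] says
    that [mu] and the multiplicative convolution of [nu] with itself have the
    same moments, so one expects [X = S * S], the set of products of two elements
    of [S].  This is seen by testing both sets with polynomials.  The moments
    determine the functional [p |-> \int p], and for [p >= 0] on the half-line
    [\int p = 0] means exactly that [p] vanishes on the support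
    ([riesz_eq0P]).  For a square [p = q ^ 2],
    [\int q ^ 2 d mu = \int \int q (s t) ^ 2 d nu (t) d nu (s)] holds moment by
    moment, and applying the criterion to both iterated integrals shows that [q]
    vanishes on [X] iff it vanishes on [S * S].  When [X] is finite this forces
    [X = S * S] ([msupport_sqrt_seq]), and [S] is finite too.

    What remains is the question of which sizes [M = |S * S|] occur when
    [|S| = N].  For positive reals [2 N - 1 <= M <= N (N + 1) / 2]
    ([square_size_lb], [square_size_ub]), and every [M] in this range occurs for
    some [S] made of powers of 2, that is, for the sumset of some set of natural
    numbers ([ex_square_size]).  Conversely the sum of the point masses at the
    elements of such an [S] has the moments [\sum_(x in S) x ^ n], whose squares
    are the moments of the point masses at all products
    ([frakS_half2_power_sums]).

    The two inequalities are those defining [A_set] ([A_setP]).  They have no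
    solution [N] for [M = 2] and [M = 4]; for every other [M >= 1],
    [N = (M + 1) / 2] rounded down is one. *)

(** * Supports and positive polynomials *)

Section Support.
Local Open Scope ring_scope.
Variable R : realType.
Implicit Types (a b : R^nat) (p q : {poly R}).
Implicit Types mu nu : {measure set (measurableTypeR R) -> \bar R}.

(** Each point outside the support has a null neighbourhood, and countably many
    intervals with rational endpoints suffice to cover these points. *)
Lemma negligible_setC_msupport mu : mu.-negligible (~` msupport mu).
Proof.
pose I (n : nat) : set R :=
  if unpickle n is Some (u, v) then `]ratr u, ratr v[%classic else set0.
pose F n : set R := if mu (I n) == 0%E then I n else set0.
have mI n : measurable (I n : set (measurableTypeR R)).
  rewrite /I; case: unpickle => [[u v]|]; last exact: measurable0.
  exact: measurable_itv.
apply: (@negligibleS _ _ _ mu (\bigcup_n F n)); last first.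
  apply: negligible_bigcup => k; rewrite /F; case: eqP => [mu0|_].
    by apply/negligibleP.
  exact: negligible_set0.
move=> x /= /existsNP[U] /not_implyP[oU] /not_implyP[Ux].
rewrite lt0e measure_ge0 andbT => /negP; rewrite negbK => /eqP muU.
have /nbhs_ballP[e /= e0 xeU] := open_nbhs_nbhs (conj oU Ux).
have [u] : exists u, ratr u \in `]x - e, x[ by apply: rat_in_itvoo; lra.
have [v] : exists v, ratr v \in `]x, x + e[ by apply: rat_in_itvoo; lra.
rewrite !in_itv /= => /andP[xv ve] /andP[eu ux].
exists (pickle (u, v)) => //; rewrite /F /I pickleK ifT /=; last first.
  apply/eqP/(subset_measure0 _ _ _ muU) => //=.
    exact: open_measurable.
  move=> y; rewrite /= in_itv /= => /andP[uy yv]; apply: xeU.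
  by rewrite ball_itv /= in_itv /=; apply/andP; split; lra.
by rewrite in_itv /= ux.
Qed.

Lemma msupport_ge0 mu x : on_nonneg mu -> msupport mu x -> 0 <= x.
Proof.
move=> mu0 xmu; rewrite leNgt; apply/negP => x0.
have oI : open [set` `]-oo, (0 : R)[] by exact: interval_open.
have := xmu _ oI.
by rewrite mu0 ltxx /= in_itv /= => /(_ x0).
Qed.

(** The Riesz functional of the sequence [a], which is integration of
    polynomials when [a] is a moment sequence. *)
Definition riesz a p : R := \sum_(k < size p) p`_k * a k.

Lemma rieszE n a p : (size p <= n)%N -> riesz a p = \sum_(k < n) p`_k * a k.
Proof.
move=> pn; rewrite /riesz (big_ord_widen n (fun k => p`_k * a k)) //.
rewrite big_mkcond /=; apply: eq_bigr => k _; case: ltnP => // kp.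
by rewrite nth_default // mul0r.
Qed.

Lemma integral_horner mu a p : represents mu a ->
  (\int[mu]_(x in `[0%R, +oo[) (p.[x])%:E = (riesz a p)%:E)%E.
Proof.
move=> [_ mom].
have mD : measurable (`[0%R, +oo[ : set (measurableTypeR R)).
  exact: measurable_itv.
have mX n : measurable_fun (`[0%R, +oo[ : set (measurableTypeR R))
    (fun x : R => x ^+ n).
  have -> : (fun x : R => x ^+ n) = horner 'X^n.
    by apply/funext => x; rewrite hornerXn.
  exact: measurable_poly.
have intX n : mu.-integrable (`[0%R, +oo[ : set (measurableTypeR R))
    (fun x => (x ^+ n)%:E).
  apply/integrableP; split.
    by apply/measurable_EFinP; exact: mX.
  by rewrite (integral_fin_num_abs mu mD (mX n)) -mom.
under eq_integral do rewrite horner_coef -sumEFin.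
under eq_integral do under eq_bigr do rewrite EFinM.
rewrite integral_sum //; last by move=> n; apply: integrableZl.
rewrite /riesz -sumEFin; apply: eq_bigr => k _.
by rewrite integralZl // -mom EFinM.
Qed.

Lemma riesz_ge0 mu a p : represents mu a ->
  (forall x, 0 <= x -> 0 <= p.[x]) -> 0 <= riesz a p.
Proof.
move=> mua p0; rewrite -lee_fin -(integral_horner _ _ _ mua).
by apply: integral_ge0 => x /=; rewrite in_itv/= andbT lee_fin; apply: p0.
Qed.

(** A nonnegative function with zero integral vanishes almost everywhere, and
    the open set where a polynomial is nonzero is null iff it misses the
    support. *)
Lemma riesz_eq0P mu a p : represents mu a ->
  (forall x, 0 <= x -> 0 <= p.[x]) ->
  riesz a p = 0 <-> (forall x, msupport mu x -> p.[x] = 0).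
Proof.
move=> mua p0; set D : set (measurableTypeR R) := `[0%R, +oo[%classic.
have mD : measurable D by exact: measurable_itv.
have mp : measurable_fun D (fun x => (p.[x])%:E).
  by apply/measurable_EFinP; exact: measurable_poly.
have -> : riesz a p = 0 <-> ae_eq mu D (fun x => (p.[x])%:E) (cst 0%E).
  rewrite -ae_eq_integral_abs //.
  have -> : (\int[mu]_(x in D) `|p.[x]%:E| = (riesz a p)%:E)%E.
    rewrite -(integral_horner _ _ _ mua); apply: eq_integral => x.
    rewrite inE /D /= in_itv /= andbT => x0.
    by rewrite /= ger0_norm ?p0.
  by split => [->|[]].
split => [[N [mN N0 pN]] x xmu|p_supp].
  apply/eqP/negP => px0.
  have oU : open [set y | p.[y] != 0].
    have -> : [set y | p.[y] != 0] = (horner p) @^-1` [set~ 0].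
      by apply/seteqP; split => y /= /eqP.
    apply: open_comp; last by rewrite openC; exact: closed_eq.
    by move=> y _; exact: continuous_horner.
  have := xmu _ oU; rewrite lt0e => /(_ (introN idP px0))/andP[/eqP + _].
  apply.
  have mneg : measurable (`]-oo, 0%R[ : set (measurableTypeR R)).
    exact: measurable_itv.
  apply: (subset_measure0 (B := N `|` `]-oo, 0%R[)) => //.
  - exact: open_measurable.
  - exact: measurableU.
  - move=> y /= py; case: (ltP y 0) => y0; [right|left].
      by rewrite in_itv.
    apply: pN => /= h; move/eqP: py; apply.
    by apply: (EFin_inj (h _)); rewrite /D /= in_itv /= y0.
  - apply/eqP; rewrite eq_le measure_ge0 andbT.
    apply: le_trans (measureU2 _ _ _) _ => //.
    by case: mua => mu0 _; rewrite [X in (X + _)%E]N0 [X in (_ + X)%E]mu0 adde0.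
have [N [mN N0 suppN]] := negligible_setC_msupport mu.
exists N; split => // x /= /not_implyP[_ px]; apply: suppN => xmu.
by apply: px; rewrite p_supp.
Qed.

(** The functional of [a] at [p] is the functional of [sqrt_seq a], applied
    twice, at the polynomial [p (s t)] in two variables.  Testing squares with
    [riesz_eq0P] shows that the two sides have the same polynomials vanishing on
    them; products of linear factors then separate points from the finite set
    [msupport mu]. *)
Lemma msupport_sqrt_seq mu nu a : represents mu a -> represents nu (sqrt_seq a) ->
  (forall n, 0 <= a n) ->
  finite_set (msupport mu) ->
  msupport mu = [set x * y | x in msupport nu & y in msupport nu].
Proof.
move=> mua nub a0 finX; set b := sqrt_seq a in nub.
have ab n : a n = b n * b n by rewrite /b /sqrt_seq -expr2 sqr_sqrtr.
(* [sc p s] is [p (s t)] as a polynomial in [t]; [av p] is its integral over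
   [t], as a polynomial in [s]. *)
pose sc p s : {poly R} := \poly_(k < size p) (p`_k * s ^+ k).
have scE p s t : (sc p s).[t] = p.[s * t].
  rewrite horner_poly horner_coef; apply: eq_bigr => k _.
  by rewrite exprMn mulrA.
pose av p : {poly R} := \poly_(k < size p) (p`_k * b k).
have avE p s : (av p).[s] = riesz b (sc p s).
  rewrite horner_poly (rieszE (size p)) ?size_poly //; apply: eq_bigr => k _.
  by rewrite coef_poly ltn_ord mulrAC.
have riesz_av p : riesz b (av p) = riesz a p.
  rewrite (rieszE (size p)) ?size_poly //; apply: eq_bigr => k _.
  by rewrite coef_poly ltn_ord ab mulrA.
have sq_ge0 q x : 0 <= (q * q).[x] by rewrite hornerM -expr2 sqr_ge0.
have sc_ge0 q s x : 0 <= (sc (q * q) s).[x] by rewrite scE.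
have vanish q : (forall x, msupport mu x -> (q * q).[x] = 0) <->
    (forall s t, msupport nu s -> msupport nu t -> (q * q).[s * t] = 0).
  rewrite -(riesz_eq0P _ _ _ mua) // -riesz_av (riesz_eq0P _ _ _ nub); last first.
    by move=> x _; rewrite avE; apply: (riesz_ge0 _ _ _ nub).
  split => [h s t sS tS|h s sS].
    rewrite -scE; move: t tS; apply/(riesz_eq0P _ _ _ nub) => //.
    by rewrite -avE; exact: h.
  by rewrite avE; apply/(riesz_eq0P _ _ _ nub) => // t tS; rewrite scE; apply: h.
have sq0 q x : (q * q).[x] = 0 <-> root q x.
  rewrite hornerM /root; split => [/eqP|/eqP ->]; last by rewrite mul0r.
  by rewrite mulf_eq0 orbb.
have {}vanish q : (forall x, msupport mu x -> root q x) <->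
    (forall s t, msupport nu s -> msupport nu t -> root q (s * t)).
  split => h.
    by move=> s t sS tS; apply/sq0; apply: (vanish q).1 => // x xX; apply/sq0/h.
  by move=> x xX; apply/sq0; apply: (vanish q).2 => // s t sS tS; apply/sq0/h.
have [X XE] := (finite_seqP _).1 finX.
have rootX (Y : seq R) x : root (\prod_(z <- Y) ('X - z%:P)) x = (x \in Y).
  by rewrite root_prod_XsubC.
apply/seteqP; split => [x xX|_ [s sS [t tS <-]]]; last first.
  rewrite XE /= -rootX; apply: (vanish _).1 => // x.
  by rewrite XE rootX.
(* A point of [msupport mu] that is not a product is detected by the polynomial
   vanishing at all the other points of [msupport mu]. *)
apply: contrapT => xSS.
suff : root (\prod_(z <- rem x (undup X)) ('X - z%:P)) x.
  by rewrite rootX mem_rem_uniq ?undup_uniq // inE eqxx.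
apply: (vanish _).2 xX => s t sS tS.
rewrite rootX mem_rem_uniq ?undup_uniq // inE mem_undup.
apply/andP; split.
  by apply/eqP => stx; apply: xSS; exists s => //; exists t.
rewrite -rootX; apply: (vanish _).1 => // y; by rewrite XE rootX.
Qed.
End Support.

(** * Sizes of product sets and sumsets *)

Section Squaring.
Local Open Scope nat_scope.

Definition squareset {T : Type} (op : T -> T -> T) (s : seq T) : seq T :=
  [seq op x y | x <- s, y <- s].

Definition square_size {T : eqType} (op : T -> T -> T) (s : seq T) : nat :=
  size (undup (squareset op s)).

Lemma squaresetP (T : eqType) (op : T -> T -> T) s z :
  reflect (exists x y, [/\ x \in s, y \in s & z = op x y])
          (z \in squareset op s).
Proof.
apply: (iffP allpairsP) => [[[x y] [xs ys ->]]|[x [y [xs ys ->]]]].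
  by exists x, y.
by exists (x, y).
Qed.

Lemma eq_size_undup (T : eqType) (s t : seq T) :
  uniq t -> s =i t -> size (undup s) = size t.
Proof.
move=> tu st; apply/eqP; rewrite -uniq_size_uniq ?undup_uniq //.
by move=> x; rewrite mem_undup st.
Qed.

Lemma eq_square_size (T : eqType) (op : T -> T -> T) s t :
  s =i t -> square_size op s = square_size op t.
Proof.
move=> st; apply: eq_size_undup; first exact: undup_uniq.
move=> z; rewrite mem_undup.
apply/squaresetP/squaresetP => -[x [y [xs ys ->]]]; exists x, y.
  by rewrite -!st.
by rewrite !st.
Qed.

Lemma square_size_cons (T : eqType) (op : T -> T -> T) x s : commutative op ->
  square_size op (x :: s) =
  size (undup (map (op x) (x :: s) ++ squareset op s)).
Proof.
move=> opC; apply: eq_size_undup; first exact: undup_uniq.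
move=> z; rewrite mem_undup mem_cat; apply/squaresetP/orP.
  move=> [u [v [/predU1P[->|us] /predU1P[->|vs] ->]]].
  - by left; exact/map_f/mem_head.
  - by left; apply/map_f/predU1r.
  - by left; rewrite opC; apply/map_f/predU1r.
  - by right; apply/squaresetP; exists u, v.
case=> [/mapP[v vs ->]|/squaresetP[u [v [us vs ->]]]].
  by exists x, v; rewrite mem_head.
by exists u, v; rewrite !inE us vs !orbT.
Qed.

(** Adding [x] to [s] creates at most the [size s + 1] products of [x] with
    [x] and with the elements of [s]. *)
Lemma square_size_ub (T : eqType) (op : T -> T -> T) s : commutative op ->
  2 * square_size op s <= size s * (size s).+1.
Proof.
move=> opC; elim: s => // x s IH.
suff : square_size op (x :: s) <= (size s).+1 + square_size op s by move=> /=; nia.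
rewrite square_size_cons // undup_cat size_cat leq_add2r.
rewrite size_filter (leq_trans (count_size _ _)) //.
by rewrite (leq_trans (size_undup _)) // size_map.
Qed.

Lemma square_size_map (T U : eqType) (opT : T -> T -> T) (opU : U -> U -> U)
    (f : T -> U) s : injective f -> {morph f : x y / opT x y >-> opU x y} ->
  square_size opU (map f s) = square_size opT s.
Proof.
move=> fI fM; rewrite /square_size.
have -> : squareset opU (map f s) = map f (squareset opT s).
  rewrite /squareset map_allpairs allpairs_mapl allpairs_mapr.
  by apply: eq_allpairs => x y; rewrite fM.
by rewrite undup_map_inj // size_map.
Qed.

(** List the elements increasingly.  Putting a new least element [x] in front of
    the former least element [y] creates two products [x * x < x * y] that are
    smaller than all the former ones. *)
Lemma square_size_lb (R : realDomainType) (s : seq R) :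
  uniq s -> all (fun x => 0 < x)%R s ->
  2 * size s <= (square_size *%R s).+1.
Proof.
move=> su s0; pose t := sort <=%O%O s.
have st : s =i t by move=> x; rewrite mem_sort.
rewrite (eq_square_size _ _ _ _ st).
have -> : size s = size t by rewrite size_sort.
have t0 : all (fun x => 0 < x)%R t by rewrite all_sort.
have : sorted <%O%O t by rewrite sort_lt_sorted.
elim: t t0 {st} => [//|x [_ _ _|y t]].
  by rewrite /square_size /squareset.
move=> IH /andP[x0 yt0] /[dup] /lt_sorted_uniq xytu /= /andP[xy yt].
have {IH}IH := IH yt0 yt; set v := undup (squareset *%R (y :: t)).
have v_gt z : z \in v -> (x * y < z)%R.
  have ge_y w : w \in y :: t -> (y <= w)%R.
    rewrite inE => /predU1P[->//|wt].
    by have /allP/(_ w wt)/ltW := order_path_min lt_trans yt.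
  rewrite mem_undup => /squaresetP[u [w [us ws ->]]].
  have := ge_y u us; have := ge_y w ws; nra.
have : uniq [:: x * x, x * y & v]%R.
  rewrite /= undup_uniq andbT inE negb_or.
  apply/andP; split; [apply/andP; split|].
  - by rewrite lt_eqF // ltr_pM2l.
  - by apply/negP => /v_gt; nra.
  - by apply/negP => /v_gt; rewrite ltxx.
move=> v_uniq.
have le_size : (square_size *%R (y :: t)).+2 <= square_size *%R [:: x, y & t].
  apply: (uniq_leq_size v_uniq) => z.
  rewrite !inE mem_undup => /or3P[/eqP ->|/eqP ->|].
  - by apply/squaresetP; exists x, x; rewrite mem_head.
  - by apply/squaresetP; exists x, y; rewrite !inE !eqxx orbT.
  rewrite mem_undup => /squaresetP[u [w [us ws ->]]].
  by apply/squaresetP; exists u, w; rewrite inE us inE ws !orbT.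
have -> : 2 * size [:: x, y & t] = (2 * size (y :: t)).+2 by rewrite mulnS.
by rewrite ltnS; apply: leq_trans le_size; rewrite ltnS.
Qed.

(** A new element exceeding twice all the others makes every sum that involves
    it new, so the number of sums grows by the largest possible amount. *)
Lemma square_size_add_large s x : uniq s -> all (fun y => 2 * y < x) s ->
  square_size addn (x :: s) = size s + (square_size addn s).+1.
Proof.
move=> su /allP sx; rewrite square_size_cons; last exact: addnC.
rewrite /square_size.
rewrite (@eq_size_undup _ _ (map (addn x) (x :: s) ++ undup (squareset addn s))).
- by rewrite size_cat size_map /= addSnnS.
- rewrite cat_uniq undup_uniq andbT map_inj_uniq; last exact: addnI.
  apply/andP; split.
    by rewrite /= su andbT; apply/negP => /sx; lia.
  apply/hasPn => z; rewrite mem_undup => /squaresetP[u [w [/sx us /sx ws ->]]].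
  by apply/negP => /mapP[y _]; lia.
- by move=> z; rewrite !mem_cat mem_undup.
Qed.

(** The sums of [0 .. n - 1] with themselves and with [n + j] fill the interval
    [0 .. 2 n + j - 1] without a gap because [j < n]; the double of [n + j] lies
    beyond it. *)
Lemma square_size_iota n j : j < n ->
  square_size addn (rcons (iota 0 n) (n + j)) = 2 * n + j.+1.
Proof.
move=> jn.
rewrite /square_size (@eq_size_undup _ _ (rcons (iota 0 (2 * n + j)) (2 * (n + j)))).
- by rewrite size_rcons size_iota addnS.
- by rewrite rcons_uniq iota_uniq mem_iota andbT; lia.
have memE k l z : (z \in rcons (iota 0 k) l) = (z < k) || (z == l).
  by rewrite mem_rcons inE mem_iota add0n orbC.
move=> z; rewrite memE; apply/squaresetP/idP.
  move=> [x [y []]]; rewrite !memE => /orP[xn|/eqP ->] /orP[yn|/eqP ->] ->; lia.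
move=> /orP[zn|/eqP ->]; last first.
  by exists (n + j), (n + j); rewrite memE eqxx orbT; split => //; lia.
case: (ltnP z (2 * n).-1) => zn'.
  by exists (minn z n.-1), (z - minn z n.-1); rewrite !memE; split; lia.
by exists (n + j), (z - (n + j)); rewrite !memE; split; lia.
Qed.

(** Going from [N] to [N + 1] elements, the values [M] from [2 N + 1] to [3 N]
    come from an initial segment and one more point; for larger [M], a set of [N]
    elements with [M - (N + 1)] sums exists by induction and is extended by a
    large element. *)
Lemma ex_square_size N M : 1 <= N -> 2 * N <= M.+1 -> 2 * M <= N * N.+1 ->
  exists s : seq nat, [/\ uniq s, size s = N & square_size addn s = M].
Proof.
elim: N M => // N IH M _ NM MN.
have [N0|N1] := posnP N.
  by exists [:: 0]; split; rewrite ?N0 //= /square_size /=; nia.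
have [M_small|M_large] := leqP M (3 * N).
  exists (rcons (iota 0 N) (N + (M - (2 * N).+1))); split.
  - by rewrite rcons_uniq iota_uniq mem_iota andbT; lia.
  - by rewrite size_rcons size_iota.
  - by rewrite square_size_iota; lia.
have [|||s [su sN sM]] := IH (M - N.+1); [lia|lia|nia|].
pose m := \max_(y <- s) y.
have le_m y : y \in s -> y <= m by move=> ys; apply: leq_bigmax_seq.
exists ((2 * m).+1 :: s); split.
- by rewrite /= su andbT; apply/negP => /le_m; lia.
- by rewrite /= sN.
- rewrite square_size_add_large ?sN ?sM //; first lia.
  by apply/allP => y /le_m; lia.
Qed.
End Squaring.

(** * Finite sums of point masses *)

Section Atomic.
Local Open Scope ring_scope.
Variable R : realType.
Implicit Types (s : seq R) (a : R^nat).

Definition dirac_sum s : {measure set (measurableTypeR R) -> \bar R} :=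
  msum (fun i => \d_(nth 0 s i : measurableTypeR R)) (size s).

Definition power_sums s : R^nat := fun n => \sum_(x <- s) x ^+ n.

Lemma dirac_sumE s (U : set R) :
  dirac_sum s U = (\sum_(x <- s) (\1_U x)%:E)%E.
Proof. by rewrite (big_nth 0) big_mkord. Qed.

Lemma dirac_sum_eq0 s (U : set R) :
  (forall x, x \in s -> ~ U x) -> dirac_sum s U = 0%E.
Proof.
move=> sU; rewrite dirac_sumE big1_seq // => x /andP[_ /sU Ux].
by rewrite indicE memNset.
Qed.

Lemma dirac_sum_gt0 s (U : set R) x :
  x \in s -> U x -> (0 < dirac_sum s U)%E.
Proof.
move=> xs Ux; rewrite dirac_sumE sumEFin lte_fin (big_rem x xs) /=.
by rewrite indicE mem_set // ltr_pwDl // sumr_ge0.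
Qed.

Lemma msupport_dirac_sum s : msupport (dirac_sum s) = [set` s].
Proof.
apply/seteqP; split => [x xs|x xs U _ Ux]; last exact: dirac_sum_gt0 xs Ux.
apply: contrapT => /= nxs.
have sC : open (~` [set` s]).
  apply: closed_openC; apply: compact_closed.
    exact: (@norm_hausdorff R R^o).
  exact/finite_compact/finite_seq.
have := xs _ sC nxs; rewrite dirac_sum_eq0 ?ltxx // => y ys.
by apply.
Qed.

Lemma dirac_sum_represents s : all (fun x => 0 <= x) s ->
  represents (dirac_sum s) (power_sums s).
Proof.
move=> /allP s0; split.
  apply: dirac_sum_eq0 => x /s0 x0; rewrite /= in_itv /= => xlt0.
  by rewrite ltNge x0 in xlt0.
move=> n.
have mD : measurable (`[0%R, +oo[ : set (measurableTypeR R)).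
  exact: measurable_itv.
have mX : measurable_fun (`[0%R, +oo[ : set (measurableTypeR R))
    (fun x : R => (x ^+ n)%:E).
  have -> : (fun x : R => (x ^+ n)%:E) = EFin \o horner 'X^n.
    by apply/funext => x; rewrite /= hornerXn.
  by apply/measurable_EFinP; exact: measurable_poly.
rewrite ge0_integral_measure_sum //; last first.
  by move=> x /=; rewrite in_itv /= andbT => x0; rewrite lee_fin exprn_ge0.
rewrite /power_sums (big_nth 0) big_mkord -sumEFin; apply: eq_bigr => i _.
rewrite integral_dirac // diracE mem_set ?mul1e //=.
by rewrite in_itv /= andbT s0 // mem_nth.
Qed.

Lemma card_set_seq s n : ([set` s] #= `I_n)%card <-> size (undup s) = n.
Proof.
have -> : [set` s] = [set` [fset x in s]%fset].
  by apply/seteqP; split => x /=; rewrite !inE.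
by rewrite -card_fseq; split => /card_eq_fsetP.
Qed.

Lemma frakS_power_sums s : all (fun x => 0 < x) s ->
  frakS (size (undup s)) (power_sums s).
Proof.
move=> s_gt0; have s_ge0 : all (fun x => 0 <= x) s.
  by apply: sub_all s_gt0 => x /ltW.
have rep := dirac_sum_represents _ s_ge0.
split.
  split; last by exists (dirac_sum s).
  by move=> n; rewrite /power_sums big_seq sumr_ge0 // => x /(allP s_ge0) x0;
    rewrite exprn_ge0.
exists (dirac_sum s); rewrite msupport_dirac_sum; split => //.
  by move=> x /= /(allP s_gt0); rewrite in_itv /= andbT.
exact/card_set_seq.
Qed.

(** Expanding the square of a power sum gives the power sum over all products
    of pairs. *)
Lemma sqrt_power_sums s : all (fun x => 0 < x) s ->
  sqrt_seq (power_sums (squareset *%R s)) = power_sums s.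
Proof.
move=> /allP s0; apply/funext => n; rewrite /sqrt_seq /power_sums.
have -> : \sum_(x <- squareset *%R s) x ^+ n = (\sum_(x <- s) x ^+ n) ^+ 2.
  rewrite big_allpairs_dep expr2 big_distrlr /=.
  by do 2![apply: eq_bigr => ? _]; rewrite exprMn.
rewrite sqrtr_sqr ger0_norm // big_seq sumr_ge0 // => x /s0 x0.
by rewrite exprn_ge0 // ltW.
Qed.

(** Repeated products only merge point masses, so the support of the measure for
    the squares has [square_size *%R s] points. *)
Lemma frakS_half2_power_sums s : uniq s -> all (fun x => 0 < x) s ->
  frakS_half2 (square_size *%R s) (size s) (power_sums (squareset *%R s)).
Proof.
move=> su s0; split.
  apply: frakS_power_sums; apply/allP => _ /squaresetP[x [y [xs ys ->]]].
  by rewrite mulr_gt0 // (allP s0).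
by rewrite sqrt_power_sums // -{1}(undup_id su); exact: frakS_power_sums.
Qed.

(** A representing measure of the square root does not have [0] in its support,
    since [0 * 0] would be a point of the support for [a]; and its support is finite because
    multiplying it by one of its points maps it into a finite set. *)
Lemma sqrt_seq_msupport M a (nu : {measure set (measurableTypeR R) -> \bar R}) :
  frakS M a -> represents nu (sqrt_seq a) ->
  exists s, [/\ uniq s, all (fun x => 0 < x) s, msupport nu = [set` s] &
                square_size *%R s = M].
Proof.
move=> [[a0 _] [mu [mua mu_gt0 muM]]] nua.
have finX : finite_set (msupport mu) by apply/finite_setP; exists M.
have XE := msupport_sqrt_seq _ _ _ _ mua nua a0 finX.
have nu_gt0 x : msupport nu x -> 0 < x.
  move=> xnu; have xx : msupport mu (x * x) by rewrite XE; exists x => //; exists x.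
  have := mu_gt0 _ xx; rewrite /= in_itv /= andbT.
  have := msupport_ge0 _ _ _ (nua.1) xnu; rewrite le_eqVlt => /predU1P[<-|//].
  by rewrite mulr0 ltxx.
have [s sE] : exists s, msupport nu = [set` s].
  apply/finite_seqP; have [->|/set0P[x xnu]] := eqVneq (msupport nu) set0.
    exact: finite_set0.
  apply: (sub_finite_set _ (finite_image (fun y => y / x) finX)) => y ynu.
  exists (y * x); first by rewrite XE; exists y => //; exists x.
  by rewrite mulfK // gt_eqF // nu_gt0.
have sE' : msupport nu = [set` undup s].
  by rewrite sE; apply/seteqP; split => x /=; rewrite mem_undup.
exists (undup s); split; rewrite ?undup_uniq //.
  by apply/allP => x xs; apply: nu_gt0; rewrite sE'.
apply/card_set_seq; rewrite (_ : [set` _] = msupport mu) // XE sE'.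
apply/seteqP; split => x /=.
  by move=> /squaresetP[y [z [ys zs ->]]]; exists y => //; exists z.
by move=> [y ys [z zs <-]]; apply/squaresetP; exists y, z.
Qed.
End Atomic.

(** * The admissible values of N *)

Section Main.
Local Open Scope ring_scope.

Lemma A_setP (R : realType) M N : A_set R M N <->
  [/\ (1 <= N)%N, (2 * N <= M.+1)%N & (2 * M <= N * N.+1)%N].
Proof.
have lb : (n_minus R M <= N%:Z) = (2 * M <= N * N.+1)%N.
  rewrite /n_minus ceil_le_int ler_pdivrMr // lerBlDr -pmulrn.
  have -> : N%:R * 2 + 1 = (2 * N + 1)%:R :> R.
    by rewrite natrD natrM mulrC.
  rewrite -[X in _ <= X](ger0_norm (ler0n _ _)) -sqrtr_sqr.
  rewrite ler_psqrt ?nnegrE ?sqr_ge0 ?ler0n // -natrX ler_nat.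
  by lia.
have ub : (N%:Z <= n_plus R M) = (2 * N <= M.+1)%N.
  rewrite /n_plus floor_ge_int ler_pdivlMr // -pmulrn -natrM ler_nat.
  by rewrite mulnC addn1.
rewrite /A_set /= lb ub; split => [[? /andP[]]|[? -> ->]] //.
Qed.

Lemma frakS_half_bounds (R : realType) M (a : R^nat)
    (nu : {measure set (measurableTypeR R) -> \bar R}) :
  (1 <= M)%N -> frakS M a -> represents nu (sqrt_seq a) ->
  exists2 N, (msupport nu #= `I_N)%card & A_set R M N.
Proof.
move=> M1 aM nua; have [s [su s0 sE sM]] := sqrt_seq_msupport _ _ _ _ aM nua.
exists (size s); first by rewrite sE; apply/card_set_seq; rewrite undup_id.
apply/A_setP; rewrite -sM; split.
- by rewrite lt0n size_eq0; apply/eqP => s_nil; rewrite -sM s_nil in M1.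
- exact: square_size_lb.
- by apply: square_size_ub; exact: mulrC.
Qed.

(** The map [n |-> 2 ^ n] turns a sumset of natural numbers into a product set of
    positive reals of the same size. *)
Lemma frakS_half2_nonempty (R : realType) M N :
  A_set R M N -> @frakS_half2 R M N !=set0.
Proof.
move=> /A_setP[N1 NM MN]; have [s [su sN sM]] := ex_square_size _ _ N1 NM MN.
pose f n : R := 2 ^+ n.
have fI : injective f by move=> m n; apply: ieexprIn; rewrite ?ltr1n ?pnatr_eq1.
have fM : {morph f : m n / (m + n)%N >-> m * n} by move=> m n; exact: exprD.
exists (power_sums R (squareset *%R (map f s))).
rewrite -sM -sN -(square_size_map _ _ addn *%R f s fI fM) -(size_map f s).
apply: frakS_half2_power_sums; first by rewrite map_inj_uniq.
by apply/allP => _ /mapP[n _ ->]; rewrite exprn_gt0.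
Qed.
End Main.

Theorem corollary8p2 (R : realType) :
  (forall M : nat, M = 2%N \/ M = 4%N -> @frakS_half R M = set0) /\
  (forall M : nat, (1 <= M)%N -> M <> 2%N -> M <> 4%N ->
    [/\ A_set R M !=set0,
        forall N : nat, A_set R M N -> @frakS_half2 R M N !=set0 &
        forall N : nat, (1 <= N)%N -> ~ A_set R M N ->
          @frakS_half2 R M N = set0]).
Proof.
split=> [M M24|M M1 M2 M4].
  apply/seteqP; split => // a [aM [_ [nu nua]]].
  have M1 : (1 <= M)%N by lia.
  have [N _ /A_setP[N1 NM MN]] := frakS_half_bounds _ _ _ _ M1 aM nua.
  (* Two elements give at most 3 products, three elements at least 5. *)
  have : (N <= 2 \/ 3 <= N)%N by lia.
  by move=> [N2|N3]; [|lia]; case: M24 => M24; nia.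
split.
- exists (M.+1 %/ 2)%N; apply/A_setP.
  have [n [] Mn] : exists n, M = (2 * n)%N \/ M = (2 * n).+1.
  - by exists (M %/ 2)%N; lia.
  - rewrite Mn in M1 M2 M4 *; have -> : ((2 * n).+1 %/ 2 = n)%N by lia.
    by split; nia.
  - rewrite Mn in M1 M2 M4 *; have -> : ((2 * n).+2 %/ 2 = n.+1)%N by lia.
    by split; nia.
- by move=> N; apply: frakS_half2_nonempty.
- move=> N _ NA; apply/seteqP; split => // a [aM [_ [nu [nua _ nuN]]]].
  have [N' nuN' N'A] := frakS_half_bounds _ _ _ _ M1 aM nua.
  apply: NA; rewrite (_ : N = N') //; apply/card_eq_II.
  exact: card_eq_trans (card_esym nuN) nuN'.
Qed.
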